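(* Let $M\in\mathbb{N}$ be even, $M\ge2$, and $n=M/2$. The extended Gramian closure $\mathcal{C}:\mathcal{R}\to\mathbb{R}$ for even $M$, $$u_{2n+1}=\mathcal{C}(u_0,\dots,u_{2n})=u_{n+1,2n}^{T}G_{n-1}^{-1}u_{n,2n-1}+\chi\,\frac{\sigma_{n,n}}{\sigma_{n-1,n-1}}\,\sigma_{n-1,n},$$ with $\chi=\frac{n+1}{n}$ is equilibrium-preserving for Gaussian equilibria.
   Context: Realizable moments: $\mathcal{R}\subset\mathbb{R}^{M+1}$ is the set of vectors $(u_0,\dots,u_M)$ with $u_k=\int_{\mathbb{R}}c^kf(c)\,dc$ for some measurable $f:\mathbb{R}\to[0,\infty)$, not almost everywhere zero, with finite moments up to order $M$. Gramian matrix: $G_k=(u_{i+j})_{i,j=0,\dots,k}\in\mathbb{R}^{(k+1)\times(k+1)}$; it is symmetric positive definite for $2k\le M$ and realizable moments. For $k\le l$, $u_{k,l}=(u_k,u_{k+1},\dots,u_l)^T$. Terms involving the empty matrix $G_{-1}$ are zero. For $k\ge0$, $$\sigma_{k,k}=u_{2k}-u_{k,2k-1}^TG_{k-1}^{-1}u_{k,2k-1},\qquad \sigma_{k,k+1}=u_{2k+1}-u_{k+1,2k}^TG_{k-1}^{-1}u_{k,2k-1}.$$ Gaussian equilibria: the distributions $$f^{(\mathrm{eq})}(c)=\frac{\rho}{(2\pi\theta)^{1/2}}\exp\left(-\frac{(c-v)^2}{2\theta}\right),\qquad \rho,\theta>0,\ v\in\mathbb{R},$$ with moments $u_k^{(\mathrm{eq})}=\int_{\mathbb{R}}c^kf^{(\mathrm{eq})}(c)\,dc$.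 Equilibrium preservation: $\mathcal{C}$ is equilibrium-preserving if $u_{M+1}^{(\mathrm{eq})}=\mathcal{C}(u_0^{(\mathrm{eq})},\dots,u_M^{(\mathrm{eq})})$ for the moments of any equilibrium distribution. *)

(* Defs.v *)
From HB Require Import structures.
From mathcomp Require Import all_boot all_order all_algebra.
From mathcomp Require Import all_classical all_reals all_analysis.
From mathcomp Require Import measurable_realfun.
From mathcomp Require Import ring.

Set Implicit Arguments.
Unset Strict Implicit.
Unset Printing Implicit Defensive.

Import Order.TTheory GRing.Theory Num.Theory.
Import numFieldNormedType.Exports.

Local Open Scope classical_set_scope.
Local Open Scope ring_scope.

Definition moment (R : realType) (f : R -> R) (k : nat) : R :=
  Rintegral lebesgue_measure setT (fun c => c ^+ k * f c).

Definition moments (R : realType) (M : nat) (f : R -> R) : 'rV[R]_M.+1 :=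
  \row_(k < M.+1) moment f k.

Definition finite_moments (R : realType) (M : nat) (f : R -> R) : Prop :=
  forall k : nat, (k <= M)%N ->
    lebesgue_measure.-integrable [set: R] (fun c => (c ^+ k * f c)%:E).

Definition admissible (R : realType) (M : nat) (f : R -> R) : Prop :=
  [/\ measurable_fun [set: R] f,
      (forall c, 0 <= f c),
      ~ {ae lebesgue_measure, forall c : R, f c = 0} &
      finite_moments M f].

Definition realizable (R : realType) (M : nat) : set 'rV[R]_M.+1 :=
  [set u | exists2 f : R -> R, admissible M f & u = moments M f].
Arguments realizable : clear implicits.

(* [entry u k] is u_k; it is only meaningful for [k <= M]. *)
Definition entry (R : realType) (M : nat) (u : 'rV[R]_M.+1) (k : nat) : R :=
  u ord0 (inord k).

(* Indexed by its size: [gram u k] is the Gramian G_(k-1), so that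
   [gram u 0] is the empty matrix G_(-1). *)
Definition gram (R : realType) (u : nat -> R) (k : nat) : 'M[R]_k :=
  \matrix_(i < k, j < k) u (i + j)%N.

(* Indexed by start and length: [seg u k m] is u_(k,k+m-1). *)
Definition seg (R : realType) (u : nat -> R) (k m : nat) : 'cV[R]_m :=
  \col_(i < m) u (k + i)%N.

(* (u_(a,a+k-1))^T G_(k-1)^-1 u_(b,b+k-1), which is 0 for k = 0.  The Gramian
   of realizable moments is positive definite as long as all its entries
   are among u_0, ..., u_M, so [invmx] is then the true inverse. *)
Definition gram_form (R : realType) (u : nat -> R) (k a b : nat) : R :=
  ((seg u a k)^T *m invmx (gram u k) *m seg u b k) ord0 ord0.

(* sigma_(k,k) *)
Definition sigma_diag (R : realType) (u : nat -> R) (k : nat) : R :=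
  u (2 * k)%N - gram_form u k k k.

(* sigma_(k,k+1) *)
Definition sigma_next (R : realType) (u : nat -> R) (k : nat) : R :=
  u (2 * k).+1%N - gram_form u k k.+1 k.

Definition extended_gramian_closure (R : realType) (M : nat) (chi : R)
    (w : realizable R M) : R :=
  let u := entry (val w) in
  let n := M./2 in
  gram_form u n n.+1 n
  + chi * (sigma_diag u n / sigma_diag u n.-1) * sigma_next u n.-1.

Definition gaussian (R : realType) (rho v theta : R) (c : R) : R :=
  rho / Num.sqrt (2 * pi * theta) * expR (- (c - v) ^+ 2 / (2 * theta)).

Lemma pow_le_expR_sqr (R : realType) (v s : R) (k : nat) : 0 < s ->
  exists2 K : R, 0 <= K &
    forall c : R, `|c| ^+ k <= K * expR ((c - v) ^+ 2 / s).
Proof.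
move=> s0; set t := s * k.+1%:R.
have t0 : 0 < t by rewrite mulr_gt0 // ltr0n.
have L0 : 0 <= `|v| + 1 + t by rewrite !addr_ge0 // ltW.
exists ((`|v| + 1 + t) ^+ k); first exact: exprn_ge0.
move=> c; have q0 : 0 <= (c - v) ^+ 2 / t by rewrite divr_ge0 ?sqr_ge0 // ltW.
have cle : `|c| <= (`|v| + 1 + t) * expR ((c - v) ^+ 2 / t).
  apply: (@le_trans _ _ ((`|v| + 1 + t) * (1 + (c - v) ^+ 2 / t))); last first.
    by rewrite ler_wpM2l // expR_ge1Dx.
  apply: (@le_trans _ _ (`|v| + 1 + (c - v) ^+ 2)).
    have -> : c = v + (c - v) by rewrite addrC subrK.
    apply: (le_trans (ler_normD _ _)); rewrite -addrA lerD2l addrAC subrr add0r.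
    rewrite -(@real_normK _ (c - v)) ?num_real //.
    have [h|h] := leP `|c - v| 1.
      by rewrite (le_trans h) // lerDl sqr_ge0.
    by rewrite (@le_trans _ _ (`|c - v| ^+ 2)) ?lerDr // ler_eXnr // ltW.
  rewrite mulrDr mulr1 lerD //; first by rewrite lerDl ltW.
  rewrite mulrDl [X in _ <= _ + X]mulrC divfK ?gt_eqF //.
  by rewrite lerDr mulr_ge0 // addr_ge0.
apply: (@le_trans _ _ (((`|v| + 1 + t) * expR ((c - v) ^+ 2 / t)) ^+ k)).
  by rewrite lerXn2r // nnegrE // mulr_ge0 // expR_ge0.
rewrite exprMn ler_wpM2l ?exprn_ge0 // -expRM_natl mulr_natl ler_expR /t.
have -> : (c - v) ^+ 2 / (s * k.+1%:R) *+ k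
    = (c - v) ^+ 2 / s * (k%:R / k.+1%:R).
  by rewrite -mulr_natr invfM -!mulrA (mulrC _^-1 k%:R).
rewrite ler_piMr //; first by rewrite divr_ge0 ?sqr_ge0 // ltW.
by rewrite ler_pdivrMr ?ltr0n // mul1r ler_nat.
Qed.

Lemma measurable_gaussian (R : realType) (rho v theta : R) :
  measurable_fun [set: R] (gaussian rho v theta).
Proof.
apply: measurable_funM => //; apply: measurableT_comp => //=.
apply: measurable_funM => //; apply: measurableT_comp => //=.
by apply: measurable_funX => //; exact: measurable_funB.
Qed.

Lemma gaussian_gt0 (R : realType) (rho v theta : R) :
  0 < rho -> 0 < theta -> forall c, 0 < gaussian rho v theta c.
Proof.
move=> r0 t0 c; rewrite mulr_gt0 ?expR_gt0 // divr_gt0 // sqrtr_gt0.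
by rewrite !mulr_gt0 // pi_gt0.
Qed.

Lemma gaussian_finite_moments (R : realType) (M : nat) (rho v theta : R) :
  0 < rho -> 0 < theta -> finite_moments M (gaussian rho v theta).
Proof.
move=> r0 t0 k _.
have s0 : 0 < 4 * theta by rewrite mulr_gt0.
have [K K0 HK] := pow_le_expR_sqr v k s0.
pose sg := Num.sqrt (2 * theta).
have sg2 : sg ^+ 2 = 2 * theta by rewrite sqr_sqrtr // mulr_ge0 // ltW.
have sgN0 : sg != 0 by rewrite gt_eqF // sqrtr_gt0 mulr_gt0.
have p0 : 0 < normal_peak sg by exact: normal_peak_gt0.
pose A := rho / Num.sqrt (2 * pi * theta).
have A0 : 0 <= A by rewrite divr_ge0 ?sqrtr_ge0 // ltW.
pose C := K * A / normal_peak sg.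
have iC : lebesgue_measure.-integrable [set: R]
    (fun c => C%:E * (normal_pdf v sg c)%:E)%E.
  by apply: integrableZl => //; exact: integrable_normal_pdf.
apply: le_integrable iC => //.
- apply/measurable_EFinP; apply: measurable_funM => //.
  exact: measurable_gaussian.
- move=> c _ /=; rewrite lee_fin normrM normrX.
  rewrite (ger0_norm (ltW (gaussian_gt0 v r0 t0 c))).
  rewrite [leRHS]ger0_norm; last first.
    by rewrite mulr_ge0 ?normal_pdf_ge0 // divr_ge0 ?mulr_ge0 // ltW.
  rewrite normal_pdfE // /gaussian -/A.
  have -> : C * (normal_peak sg * normal_fun v sg c)
      = K * A * normal_fun v sg c by rewrite /C mulrA divfK ?gt_eqF.
  apply: (@le_trans _ _ (K * expR ((c - v) ^+ 2 / (4 * theta)) *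
      (A * expR (- (c - v) ^+ 2 / (2 * theta))))).
    by rewrite ler_wpM2r // mulr_ge0 // expR_ge0.
  rewrite mulrACA (ler_wpM2l (mulr_ge0 K0 A0)) // -expRD /normal_fun ler_expR sg2.
  rewrite le_eqVlt; apply/orP; left; apply/eqP.
  have thN0 : theta != 0 by rewrite gt_eqF.
  by field.
Qed.

Lemma gaussian_realizable (R : realType) (M : nat) (rho v theta : R) :
  0 < rho -> 0 < theta -> realizable R M (moments M (gaussian rho v theta)).
Proof.
move=> r0 t0; exists (gaussian rho v theta) => //; split.
- exact: measurable_gaussian.
- by move=> c; apply/ltW/gaussian_gt0.
- move=> [N [mN N0 sub]].
  have NT : N = setT.
    apply/seteqP; split => // c _; apply: sub => /= gc0.
    by have := gaussian_gt0 v r0 t0 c; rewrite gc0 ltxx.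
  have : (lebesgue_measure [set: R] = 0)%E by rewrite -NT.
  by rewrite -set_itvNyy lebesgue_measure_itv.
- exact: gaussian_finite_moments.
Qed.

Definition equilibrium_moments (R : realType) (M : nat) (rho v theta : R)
    (hrho : 0 < rho) (htheta : 0 < theta) : realizable R M :=
  SigSub (mem_set (gaussian_realizable M v hrho htheta)).

Definition equilibrium_preserving (R : realType) (M : nat)
    (C : realizable R M -> R) : Prop :=
  forall (rho v theta : R) (hrho : 0 < rho) (htheta : 0 < theta),
    moment (gaussian rho v theta) M.+1 = C (equilibrium_moments M v hrho htheta).

(* Main.v *)
(** Let L be the linear functional with L(X^k) = u_k.  Integration by parts
    against a Gaussian gives L((X - v) p) = theta L(p').  The Hermite polynomials
    h_(n+1) = (X - v) h_n - theta h_n' therefore satisfy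
    L(p h_n) = theta^n L(p^(n)), so h_n is the monic polynomial of degree n
    orthogonal to all lower degrees.  Hence sigma_(n,n) = L(X^n h_n) =
    theta^n n! u_0 and sigma_(n,n+1) = L(X^(n+1) h_n) = theta^n (n+1)! v u_0,
    which turns the closure relation into
    sigma_(n,n+1) = (n+1)/n * sigma_(n,n) / sigma_(n-1,n-1) * sigma_(n-1,n). *)
From HB Require Import structures.
Require Import Defs.
From mathcomp Require Import all_boot all_order all_algebra.
From mathcomp Require Import all_classical all_reals all_analysis.
From mathcomp Require Import ring zify measurable_realfun.

Set Implicit Arguments.
Unset Strict Implicit.
Unset Printing Implicit Defensive.

Import Order.TTheory GRing.Theory Num.Theory.
Import numFieldNormedType.Exports.

Local Open Scope classical_set_scope.
Local Open Scope ring_scope.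

(** * The linear functional of a moment sequence *)

Definition moment_fun (R : realType) (u : nat -> R) (p : {poly R}) : R :=
  \sum_(i < size p) p`_i * u i.

Lemma moment_funE (R : realType) (u : nat -> R) (p : {poly R}) (m : nat) :
  (size p <= m)%N -> moment_fun u p = \sum_(i < m) p`_i * u i.
Proof.
move=> pm; rewrite /moment_fun (big_ord_widen m (fun i => p`_i * u i)) //.
rewrite big_mkcond; apply: eq_bigr => i _; case: ltnP => // ip.
by rewrite nth_default // mul0r.
Qed.

Lemma moment_fun_is_linear (R : realType) (u : nat -> R) :
  linear (moment_fun u : {poly R} -> R^o).
Proof.
move=> a p q; set m := maxn (size p) (size q).
have pm : (size p <= m)%N by rewrite leq_maxl.
have qm : (size q <= m)%N by rewrite leq_maxr.
rewrite (moment_funE _ pm) (moment_funE _ qm) (@moment_funE _ _ _ m).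
  rewrite scaler_sumr -big_split; apply: eq_bigr => i _.
  by rewrite coefD coefZ mulrDl -mulrA.
by rewrite (leq_trans (size_polyD _ _)) // geq_max qm (leq_trans (size_scale_leq _ _)).
Qed.

HB.instance Definition _ (R : realType) (u : nat -> R) :=
  GRing.isLinear.Build R {poly R} R^o _ (moment_fun u) (moment_fun_is_linear u).

(** Reads matrix products as values of [moment_fun u]: for a row index [a] the sum is entry [a] of
    [gram u m] times the coefficient vector of [p], and for any [a] it pairs that vector with
    [seg u a m]. *)
Lemma moment_funXnM (R : realType) (u : nat -> R) (a m : nat) (p : {poly R}) :
  (size p <= m)%N ->
  moment_fun u ('X^a * p) = \sum_(i < m) p`_i * u (a + i)%N.
Proof.
move=> pm; rewrite (@moment_funE _ _ _ (a + m)); last first.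
  by rewrite (leq_trans (size_polyMleq _ _)) // size_polyXn addSn /= leq_add2l.
rewrite big_split_ord /= big1 ?add0r => [|i _]; last first.
  by rewrite coefXnM ltn_ord mul0r.
apply: eq_bigr => i _.
by rewrite coefXnM ltnNge leq_addr /= addKn.
Qed.

Lemma moment_funXn (R : realType) (u : nat -> R) (k : nat) :
  moment_fun u 'X^k = u k.
Proof.
by rewrite -['X^k]mulr1 (@moment_funXnM _ _ _ 1) ?size_poly1 // big_ord1 coef1 mul1r addn0.
Qed.

(** On monomials this is the recurrence itself, and linearity does the rest. At [k = 0] the term
    [u k.-1] reads [u 0], but its factor is zero. *)
Lemma moment_fun_shift (R : realType) (u : nat -> R) (v theta : R) :
  (forall k, u k.+1 = v * u k + theta * (k%:R * u k.-1)) ->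
  forall p, moment_fun u (('X - v%:P) * p) = theta * moment_fun u p^`().
Proof.
move=> rec p; rewrite -[p]coefK poly_def mulr_sumr !raddf_sum /= mulr_sumr.
have ZE a q : moment_fun u (a *: q) = a * moment_fun u q by exact: linearZ.
apply: eq_bigr => i _; rewrite -scalerAr derivZ !ZE mulrCA; congr (_ * _).
rewrite mulrBl -exprS mul_polyC raddfB /= ZE derivXn -scaler_nat ZE !moment_funXn.
by rewrite rec addrC addKr.
Qed.

(** * Scaled Hermite polynomials *)

(** For [theta > 0] this is [theta ^ (n/2) * He_n ((X - v) / sqrt theta)], with [He_n] the monic
    (probabilists') Hermite polynomial. *)
Fixpoint hermite (R : realType) (v theta : R) (n : nat) : {poly R} :=
  if n is m.+1 then
    ('X - v%:P) * hermite v theta m - theta *: (hermite v theta m)^`()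
  else 1.

(** Encodes in one bound that [h_n] is monic of degree [n]; the difference [X^n - h_n] is also the
    polynomial that later solves the Gramian system. *)
Lemma size_hermiteBXn (R : realType) (v theta : R) (n : nat) :
  (size ('X^n - hermite v theta n)%R <= n)%N.
Proof.
elim: n => [|n IH] /=; first by rewrite subrr size_poly0.
set h := hermite v theta n in IH *.
have sh : (size h <= n.+1)%N.
  rewrite -[h](subKr 'X^n) (leq_trans (size_polyD _ _)) // geq_max size_polyN.
  by rewrite size_polyXn leqnn (leq_trans IH).
have -> : 'X^(n.+1) - (('X - v%:P) * h - theta *: h^`())
   = 'X * ('X^n - h) + (v *: h + theta *: h^`()).
  by rewrite -!mul_polyC exprS; ring.
rewrite (leq_trans (size_polyD _ _)) // geq_max; apply/andP; split.
  by rewrite (leq_trans (size_polyMleq _ _)) // size_polyX.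
rewrite (leq_trans (size_polyD _ _)) // geq_max; apply/andP; split.
  exact: leq_trans (size_scale_leq _ _) sh.
rewrite (leq_trans (size_scale_leq _ _)) //; apply/leq_sizeP => j nj.
by rewrite coef_deriv nth_default ?mul0rn // (leq_trans sh) // ltnW.
Qed.

Lemma size_hermite (R : realType) (v theta : R) (n : nat) :
  (size (hermite v theta n) <= n.+1)%N.
Proof.
rewrite -[hermite v theta n](subKr 'X^n) (leq_trans (size_polyD _ _)) //.
by rewrite geq_max size_polyN size_polyXn leqnn (leq_trans (size_hermiteBXn _ _ _)).
Qed.

(** * Sequences obeying the Gaussian moment recurrence *)

Section GaussianRecurrence.
Variables (R : realType) (u : nat -> R) (v theta : R).
Hypothesis rec : forall k, u k.+1 = v * u k + theta * (k%:R * u k.-1).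
Local Notation L := (moment_fun u).
Local Notation h := (hermite v theta).

(** Each induction step moves one derivative onto [p]: the shift rule turns [L (p (X - v) h_n)] into
    [theta L ((p h_n)')], and the term [theta L (p h_n')] of the product rule cancels. *)
Lemma moment_fun_hermite (p : {poly R}) (n : nat) :
  L (p * h n) = theta ^+ n * L p^`(n).
Proof.
elim: n p => [|n IH] p /=; first by rewrite mulr1 mul1r.
have ZE a q : L (a *: q) = a * L q by exact: linearZ.
rewrite mulrBr raddfB /= -scalerAr ZE mulrCA (moment_fun_shift rec) derivM.
by rewrite raddfD /= mulrDr addrK IH mulrA -exprS -derivSn.
Qed.

(** For [i < n] the falling factorial vanishes, which is the orthogonality; [i = n] and [i = n + 1]
    give the two sigmas. *)
Lemma moment_fun_Xn_hermite (i n : nat) :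
  L ('X^i * h n) = theta ^+ n * ((i ^_ n)%:R * u (i - n)%N).
Proof.
rewrite moment_fun_hermite derivnXn -scaler_nat.
have -> : L ((i ^_ n)%:R *: 'X^(i - n)) = (i ^_ n)%:R * L 'X^(i - n) by exact: linearZ.
by rewrite moment_funXn.
Qed.

Hypotheses (theta0 : theta != 0) (u0 : u 0 != 0).

(** A nonzero kernel vector would be a polynomial [p] of degree [d < k] with [L (X^j p) = 0] for all
    [j < k], hence [L (p h_d) = 0]. But this value is [theta^d d! u_0] times the leading coefficient
    of [p]. *)
Lemma gram_unit (k : nat) : gram u k \in unitmx.
Proof.
rewrite -row_free_unit -kermx_eq0; apply/rowV0P => x /sub_kermxP xG.
apply: contraTeq isT => x0; pose p := rVpoly x.
have p0 : p != 0.
  by apply: contraNneq x0 => p0; rewrite -[x]rVpolyK -/p p0 linear0.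
have sp : (size p <= k)%N by exact: size_poly.
have LX j : (j < k)%N -> L ('X^j * p) = 0.
  move=> jk; rewrite (moment_funXnM _ _ sp).
  transitivity ((x *m gram u k) ord0 (Ordinal jk)); last by rewrite xG mxE.
  by rewrite mxE; apply: eq_bigr => i _; rewrite coef_rVpoly_ord mxE addnC.
pose d := (size p).-1.
have sd : size p = d.+1 by rewrite prednK // lt0n size_poly_eq0.
have : L (p * h d) = 0.
  rewrite -[h d]coefK poly_def mulr_sumr raddf_sum big1 // => i _.
  have -> : p * ((h d)`_i *: 'X^i) = (h d)`_i *: ('X^i * p).
    by rewrite -scalerAr mulrC.
  rewrite -[RHS](mulr0 (h d)`_i) -(LX i); first exact: linearZ.
  by rewrite (leq_trans (ltn_ord i)) // (leq_trans (size_hermite _ _ _)) // -sd.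
(* The [d]-th derivative of [p] is constant, so a single term of the sum remains. *)
rewrite moment_fun_hermite (@moment_funE _ _ _ 1); last first.
  apply/leq_sizeP => j j1; rewrite coef_derivn nth_default ?mul0rn //.
  by rewrite sd -addn1 leq_add2l.
rewrite big_ord1 coef_derivn addn0 ffactnn => /eqP.
rewrite mulf_eq0 expf_eq0 (negbTE theta0) andbF mulf_eq0 (negbTE u0) orbF /=.
rewrite mulrn_eq0 -lead_coefE lead_coef_eq0 (negbTE p0) orbF.
by rewrite eqn0Ngt fact_gt0.
Qed.

(* The Hermite polynomial is orthogonal to lower degrees, so [X^k - h_k] is the
   polynomial whose coefficient vector is [G_(k-1)^-1 u_(k,2k-1)]. *)
Lemma gram_formE (k a : nat) :
  gram_form u k a k = u (a + k)%N - L ('X^a * h k).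
Proof.
pose q := 'X^k - h k; have sq : (size q <= k)%N := size_hermiteBXn v theta k.
have Gq : gram u k *m \col_(i < k) q`_i = seg u k k.
  apply/colP => i; rewrite !mxE.
  transitivity (L ('X^i * q)).
    by rewrite (moment_funXnM _ _ sq); apply: eq_bigr => j _; rewrite !mxE mulrC.
  rewrite mulrBr raddfB /= -exprD moment_funXn moment_fun_Xn_hermite.
  by rewrite ffact_small // mul0r mulr0 subr0 addnC.
rewrite /gram_form -Gq -mulmxA mulKmx ?gram_unit // mxE.
transitivity (L ('X^a * q)).
  by rewrite (moment_funXnM _ _ sq); apply: eq_bigr => j _; rewrite !mxE mulrC.
by rewrite mulrBr raddfB /= -exprD moment_funXn.
Qed.

Lemma sigma_diagE (k : nat) : sigma_diag u k = theta ^+ k * k`!%:R * u 0.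
Proof.
rewrite /sigma_diag gram_formE moment_fun_Xn_hermite ffactnn subnn.
by rewrite mul2n addnn subKr mulrA.
Qed.

Lemma sigma_nextE (k : nat) :
  sigma_next u k = theta ^+ k * k.+1`!%:R * (v * u 0).
Proof.
(* The functional leaves [u 1], which the recurrence at 0 turns into [v * u 0]. *)
rewrite /sigma_next gram_formE moment_fun_Xn_hermite subSnn (rec 0) /= mul0r mulr0 addr0.
by rewrite mul2n -addnn addSn subKr ffact_factd // subSnn (_ : 1`! = 1)%N // divn1 mulrA.
Qed.

Lemma recurrence_closure (n : nat) : (0 < n)%N ->
  u (2 * n).+1 = gram_form u n n.+1 n
    + n.+1%:R / n%:R * (sigma_diag u n / sigma_diag u n.-1) * sigma_next u n.-1.
Proof.
case: n => [//|n] _ /=; rewrite -[LHS](subrK (gram_form u n.+1 n.+2 n.+1)).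
rewrite -/(sigma_next u n.+1) addrC; congr (_ + _).
rewrite !sigma_diagE !sigma_nextE !factS !natrM exprS.
have n0 m : m.+1%:R != 0 :> R by rewrite pnatr_eq0.
have f0 : n`!%:R != 0 :> R by rewrite pnatr_eq0 -lt0n fact_gt0.
have t0 : theta ^+ n != 0 by rewrite expf_neq0.
move: (n0 n) (n.+2%:R) => n1 a.
by field; rewrite u0 f0 t0 nat1r.
Qed.

End GaussianRecurrence.

(** Passes from the full moment sequence to a truncated vector. The bounds say that the largest
    indices read, [2k - 2], [a + k - 1] and [b + k - 1], are at most [N], written without truncated
    subtraction. *)
Lemma eq_gram_form (R : realType) (N k a b : nat) (u w : nat -> R) :
  (forall i, (i <= N)%N -> u i = w i) ->
  (2 * k <= N.+2)%N -> (a + k <= N.+1)%N -> (b + k <= N.+1)%N ->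
  gram_form u k a b = gram_form w k a b.
Proof.
move=> uw kN aN bN; rewrite /gram_form.
have -> : gram u k = gram w k.
  by apply/matrixP => i j; rewrite !mxE uw //; have := ltn_ord i; have := ltn_ord j; lia.
have segE c : (c + k <= N.+1)%N -> seg u c k = seg w c k.
  by move=> cN; apply/colP => i; rewrite !mxE uw //; have := ltn_ord i; lia.
by rewrite !segE.
Qed.

(** * Integration by parts for Gaussian moments *)

(** The integral over [[-(n+1), n+1]] is [F (n+1) - F (-(n+1))], which tends to 0; by dominated
    convergence with bound [|F'|] it also tends to the full integral. *)
Lemma integral_derive1_eq0 (R : realType) (F : R -> R) :
  (forall x, derivable F x 1) -> continuous (derive1 F) ->
  lebesgue_measure.-integrable [set: R] (EFin \o (derive1 F)) ->
  F n.+1%:R @[n --> \oo] --> 0 -> F (- n.+1%:R) @[n --> \oo] --> 0 ->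
  (\int[lebesgue_measure]_x (derive1 F x)%:E = 0)%E.
Proof.
move=> dF cF' iF' Fy FNy.
pose D n : set R := [set` `[- n.+1%:R, n.+1%:R]].
have mF' : measurable_fun setT (EFin \o (derive1 F)) by exact: measurable_int iF'.
have cF : continuous F.
  by move=> x; apply: differentiable_continuous; exact/derivable1_diffP.
have intD n : (\int[lebesgue_measure]_x ((EFin \o (derive1 F)) \_ (D n)) x
    = (F n.+1%:R - F (- n.+1%:R))%:E)%E.
  rewrite -integral_mkcond.
  apply: (@continuous_FTC2 R (derive1 F) F).
  - by rewrite -subr_gt0 opprK -natrD ltr0n.
  - exact: continuous_subspaceT.
  - split => [x _ //||].
      exact/cvg_at_right_filter/cF.
    exact/cvg_at_left_filter/cF.
  - by [].
have := @dominated_convergence _ _ _ (@lebesgue_measure R) setT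
  measurableT (fun n => (EFin \o (derive1 F)) \_ (D n)) (EFin \o (derive1 F))
  (abse \o (EFin \o (derive1 F))).
case=> [|||||_ _].
- move=> n; apply/(measurable_restrictT _ _).1 => //.
    exact: measurable_itv.
  exact: measurable_funS measurableT (@subsetT _ _) mF'.
- exact: mF'.
- apply: aeW => x _; apply: cvg_near_cst; near=> n.
  rewrite patchE mem_set // /D /= in_itv /= -ler_norml.
  apply: (@le_trans _ _ n%:R); last by rewrite ler_nat.
  near: n; exact: nbhs_infty_ger.
- exact: integrable_abse.
- apply: aeW => x n _ /=; rewrite patchE; case: ifPn => _; first exact: lexx.
  by rewrite abse0 lee_fin normr_ge0.
move=> cv; apply: cvg_unique cv _ => //.
rewrite (_ : (fun n => _) = EFin \o (fun n => F n.+1%:R - F (- n.+1%:R))).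
  apply: cvg_EFin; first by near=> n.
  rewrite -(subr0 0); exact: cvgB.
by apply/funext => n; exact: intD.
Unshelve. all: by end_near. Qed.

(** The integrand is [rho] times the normal density with standard deviation [sqrt theta]. *)
Lemma gaussian_mass (R : realType) (rho v theta : R) :
  0 < theta -> moment (gaussian rho v theta) 0 = rho.
Proof.
move=> t0; have s0 : Num.sqrt theta != 0 by rewrite gt_eqF // sqrtr_gt0.
rewrite /moment.
transitivity (\int[lebesgue_measure]_x (rho * normal_pdf v (Num.sqrt theta) x)).
  apply: eq_Rintegral => x _; rewrite expr0 mul1r normal_pdfE // /gaussian.
  rewrite /normal_peak /normal_fun sqr_sqrtr ?ltW // mulrA.
  by congr (_ / Num.sqrt _ * expR (_ / _)); rewrite -mulr_natl //; ring.
rewrite RintegralZl //; last exact: integrable_normal_pdf.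
by rewrite /Rintegral integral_normal_pdf mulr1.
Qed.

(** The extra factor [|c|] yields a bound [C / |c|] that kills the boundary terms. Power [k + 1] and
    scale [2 * theta] make the exponentials cancel exactly. *)
Lemma gaussian_decay (R : realType) (rho v theta : R) (k : nat) :
  0 < rho -> 0 < theta ->
  exists C, forall c, `|c ^+ k * gaussian rho v theta c| * `|c| <= C.
Proof.
move=> r0 t0; have s0 : 0 < 2 * theta by rewrite mulr_gt0.
have [K K0 HK] := pow_le_expR_sqr v k.+1 s0.
exists (K * (rho / Num.sqrt (2 * pi * theta))) => c.
rewrite normrM normrX mulrAC -exprSr (ger0_norm (ltW (gaussian_gt0 v r0 t0 c))).
rewrite /gaussian mulNr expRN mulrCA mulrC.
rewrite ler_wpM2r //; first by rewrite divr_ge0 ?sqrtr_ge0 // ltW.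
by rewrite ler_pdivrMr ?expR_gt0.
Qed.

Lemma is_derive_gaussian_moment (R : realType) (rho v theta : R) (k : nat) (x : R) :
  0 < theta ->
  is_derive x 1 (fun c => c ^+ k * gaussian rho v theta c)
    (k%:R * (x ^+ k.-1 * gaussian rho v theta x)
     - theta^-1 * (x ^+ k.+1 * gaussian rho v theta x)
     + v / theta * (x ^+ k * gaussian rho v theta x)).
Proof.
move=> t0; set A := rho / Num.sqrt (2 * pi * theta).
(* In this point-free form the derivative is found by instance resolution on [is_derive]. *)
have -> : (fun c : R => c ^+ k * gaussian rho v theta c) =
    (id ^+ k) * (A *: (expR \o ((- (2 * theta)^-1) *: (id - cst v) ^+ 2))).
  apply/funext => c; rewrite /gaussian -/A !fctE /=.
  by congr (_ * (_ * expR _)); rewrite mulNr mulrC -mulNr.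
apply: is_derive_eq.
have -> : gaussian rho v theta x =
    A * expR ((- (2 * theta)^-1 *: (id - cst v) ^+ 2) x).
  by congr (_ * expR _); rewrite mulNr mulrC -mulNr.
rewrite !fctE /GRing.scale /=; move: (expR _) => E.
have tN0 : theta != 0 by rewrite gt_eqF.
rewrite expr1 [x ^+ k.+1]exprS; move: (x ^+ k) (x ^+ k.-1) k%:R => P Q m.
by field.
Qed.

(** Integrating the derivative of [c^k g(c)] over the line gives [0 = k u_(k-1) - u_(k+1) / theta +
    (v / theta) u_k]. *)
Lemma gaussian_moment_rec (R : realType) (rho v theta : R) (k : nat) :
  0 < rho -> 0 < theta -> let u := moment (gaussian rho v theta) in
  u k.+1 = v * u k + theta * (k%:R * u k.-1).
Proof.
move=> r0 t0 u; set g := gaussian rho v theta.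
pose F c := c ^+ k * g c.
have dF (x : R) : is_derive x 1 F (k%:R * (x ^+ k.-1 * g x)
     - theta^-1 * (x ^+ k.+1 * g x) + v / theta * (x ^+ k * g x)).
  exact: is_derive_gaussian_moment.
have F'E : derive1 F = fun x => k%:R * (x ^+ k.-1 * g x)
     - theta^-1 * (x ^+ k.+1 * g x) + v / theta * (x ^+ k * g x).
  by apply/funext => x; rewrite derive1E; exact: derive_val.
have im j : lebesgue_measure.-integrable [set: R] (fun c => (c ^+ j * g c)%:E).
  exact: (@gaussian_finite_moments _ j _ v _ r0 t0).
have iZ a j : lebesgue_measure.-integrable [set: R]
    (fun c => (a * (c ^+ j * g c))%:E).
  by under eq_fun do rewrite EFinM; exact: integrableZl.
have intZ a j : \int[lebesgue_measure]_x (a * (x ^+ j * g x)) = a * u j.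
  exact: (RintegralZl _ measurableT (im j)).
have iB : lebesgue_measure.-integrable [set: R]
    (fun x => (k%:R * (x ^+ k.-1 * g x) - theta^-1 * (x ^+ k.+1 * g x))%:E).
  by under eq_fun do rewrite EFinB; exact: integrableB.
have iF' : lebesgue_measure.-integrable [set: R] (EFin \o (derive1 F)).
  by rewrite F'E /comp; under eq_fun do rewrite EFinD; exact: integrableD.
have cF j : continuous (fun c : R => c ^+ j * g c).
  move=> x; apply: differentiable_continuous; apply/derivable1_diffP.
  by have [] := is_derive_gaussian_moment rho v j x t0.
have [C HC] := gaussian_decay v k r0 t0.
have F0 (s : nat -> R) : (forall n, `|s n| = n.+1%:R) -> F (s n) @[n --> \oo] --> 0.
  move=> sn; apply: norm_cvg0.
  apply: (@squeeze_cvgr _ _ _ _ (fun=> 0) (fun n => C * harmonic n)).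
  - apply: nearW => n; rewrite normr_ge0 /= ler_pdivlMr ?ltr0n // -sn; exact: HC.
  - exact: cvg_cst.
  - rewrite -(mulr0 C); apply: cvgMr; exact: cvg_harmonic.
have I0 : \int[lebesgue_measure]_x (derive1 F x) = 0.
  rewrite /Rintegral integral_derive1_eq0 //.
  - rewrite F'E => x; apply: cvgD.
      apply: cvgB.
        apply: cvgMr; exact: cF.
      apply: cvgMr; exact: cF.
    apply: cvgMr; exact: cF.
  - by apply: F0 => n; rewrite ger0_norm.
  - by apply: F0 => n; rewrite normrN ger0_norm.
have E : k%:R * u k.-1 - theta^-1 * u k.+1 + v / theta * u k = 0.
  rewrite -!intZ -RintegralB; [|by []|exact: iZ|exact: iZ].
  rewrite -RintegralD; [|by []|exact: iB|exact: iZ].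
  by rewrite -[RHS]I0 F'E.
have tN0 : theta != 0 by rewrite gt_eqF.
(* The difference of the two sides is [- theta] times the left side of [E]. *)
apply: subr0_eq; transitivity (- theta * 0); last by rewrite mulr0.
by rewrite -E; field.
Qed.

Theorem theorem6p3 (R : realType) (M n : nat) (hM : (2 <= M)%N)
    (heven : ~~ odd M) (hn : n = M./2) (chi : R) (hchi : chi = n.+1%:R / n%:R) :
  equilibrium_preserving (@extended_gramian_closure R M chi).
Proof.
move=> rho v theta r0 t0; subst chi n; set u := moment (gaussian rho v theta).
have rec k : u k.+1 = v * u k + theta * (k%:R * u k.-1).
  exact: gaussian_moment_rec.
have u0 : u 0 != 0 by rewrite /u gaussian_mass // gt_eqF.
have tN0 : theta != 0 by rewrite gt_eqF.
have M2 : M = (2 * M./2)%N by rewrite mul2n even_halfK.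
have n0 : (0 < M./2)%N by lia.
rewrite /extended_gramian_closure; set w := entry _.
(* The bound is what makes [inord] return the index [i] itself. *)
have uw i : (i <= M)%N -> w i = u i.
  by move=> iM; rewrite /w /entry /= mxE inordK.
transitivity (u (2 * M./2).+1); first by rewrite -M2.
rewrite (recurrence_closure rec tN0 u0 n0) /sigma_diag /sigma_next.
(* With [n = M./2], the largest index read by the closure is [2n = M], so only entries actually
   stored in the vector occur. *)
rewrite !uw ?(@eq_gram_form _ M _ _ _ w u uw) //; lia.
Qed.
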